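(* Let $X$ and $Y$ be finite nonempty sets and let $F: X \to 2^Y$ be a set-valued mapping. The following are equivalent: (i) $F$ satisfies the Hall condition; (ii) $F$ admits a Hall partition; (iii) $F$ admits an alldifferent selection.
   Context: A set-valued mapping $F: X \to 2^Y$ assigns to each $x$ a (possibly empty) subset $F(x) \subset Y$; $F(W) = \bigcup_{x\in W}F(x)$; $\sharp$ is cardinality. $F$ satisfies the Hall condition if $\sharp F(W)\ge\sharp W$ for all $W\subset X$. A selection of $F$ is a map $s: X\to Y$ with $s(x)\in F(x)$ for all $x$; it is alldifferent if it is injective. For $W \subset X$, $F_W: X\setminus W \to 2^Y$ is $F_W(x) = F(x) \setminus F(W)$. For any set-valued $G$ on a finite set, a subset $W$ of its domain is critical for $G$ if $W\ne\emptyset$ and $\sharp G(W)=\sharp W$, and non-reducible for $G$ if $W\ne\emptyset$ and no proper subset of $W$ is critical for $G$. A tuple $(W_1,\ldots,W_m)$, $m\ge1$, is a Hall partition of $F$ if the $W_i$ are nonempty, pairwise disjoint with union $X$, and with $G_i = F_{W_1\cup\cdots\cup W_{i-1}}$ ($G_1=F$): (i) $G_i(x)\neq\emptyset$ for $x \in W_i$, all $i$; (ii) $W_i$ is non-reducible for $G_i$, all $i$; (iii) $W_i$ is critical for $G_i$ for $i \le m-1$. *)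

(* Defs.v *)
From mathcomp Require Import all_boot.

Set Implicit Arguments.
Unset Strict Implicit.
Unset Printing Implicit Defensive.

Definition image_set (X Y : finType) (F : X -> {set Y}) (W : {set X}) : {set Y} :=
  \bigcup_(x in W) F x.

Definition hall_condition (X Y : finType) (F : X -> {set Y}) : Prop :=
  forall W : {set X}, #|W| <= #|image_set F W|.

Definition selection (X Y : finType) (F : X -> {set Y}) (s : X -> Y) : Prop :=
  forall x : X, s x \in F x.

Definition alldifferent_selection (X Y : finType) (F : X -> {set Y})
    (s : X -> Y) : Prop :=
  selection F s /\ injective s.

Definition critical (X Y : finType) (F : X -> {set Y}) (W : {set X}) : Prop :=
  W != set0 /\ #|image_set F W| = #|W|.

Definition non_reducible (X Y : finType) (F : X -> {set Y}) (W : {set X}) : Prop :=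
  W != set0 /\ forall V : {set X}, V \proper W -> ~ critical F V.

(* The map F_W; its domain X \ W is the subtype of elements outside W. *)
Definition reduced_map (X Y : finType) (F : X -> {set Y}) (W : {set X})
    (x : {x : X | x \notin W}) : {set Y} :=
  F (val x) :\: image_set F W.

(* A subset V of X viewed inside the domain X \ W of F_W; faithful only when
   V is disjoint from W, as is the case for the blocks of a partition. *)
Definition in_reduced_domain (X : finType) (W V : {set X}) :
    {set {x : X | x \notin W}} :=
  [set x | val x \in V].

(* Blocks are numbered from 0, so the block W_(i+1) of the usual numbering is
   W i and the last one has index m - 1. *)
Definition preceding_union (X : finType) (m : nat) (W : 'I_m -> {set X})
    (i : 'I_m) : {set X} :=
  \bigcup_(j < m | j < i) W j.

Record is_hall_partition (X Y : finType) (F : X -> {set Y})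
    (m : nat) (W : 'I_m -> {set X}) : Prop := IsHallPartition {
  hall_length : 0 < m;
  hall_nonempty : forall i, W i != set0;
  hall_disjoint : forall i j, i != j -> [disjoint W i & W j];
  hall_cover : \bigcup_(i < m) W i = [set: X];
  hall_values : forall i (x : {x : X | x \notin preceding_union W i}),
    val x \in W i -> reduced_map F x != set0;
  hall_non_reducible : forall i,
    non_reducible (@reduced_map X Y F (preceding_union W i))
                  (in_reduced_domain (preceding_union W i) (W i));
  hall_critical : forall i : 'I_m, i.+1 < m ->
    critical (@reduced_map X Y F (preceding_union W i))
             (in_reduced_domain (preceding_union W i) (W i))
}.

Definition admits_hall_partition (X Y : finType) (F : X -> {set Y}) : Prop :=
  exists (m : nat) (W : 'I_m -> {set X}), is_hall_partition F W.

Definition admits_alldifferent_selection (X Y : finType) (F : X -> {set Y}) : Prop :=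
  exists s : X -> Y, alldifferent_selection F s.

(* Main.v *)
Require Import Defs.
From mathcomp Require Import all_boot.
From mathcomp Require Import zify.

Set Implicit Arguments.
Unset Strict Implicit.
Unset Printing Implicit Defensive.

(** The blocks of a Hall partition are peeled off greedily: each block is a
    minimal critical set of the map reduced by the union [U] of the blocks
    already removed, or all that remains when no critical set is left. As the
    removed blocks are critical, [#|F(U)| = #|U|], so the Hall condition gives
    [#|F({x}) \ F(U)| >= 1] for [x] outside [U]. Conversely, adding points one
    at a time shows that a non-reducible block with nonempty values satisfies
    the Hall condition, and the sets [F_{P_i}(V ∩ W_i)], where [P_i] is the
    union of the blocks preceding [W_i], are disjoint subsets of [F(V)].
    Selections come from Hall's theorem by induction: split along a proper
    critical set if there is one; otherwise any value can be fixed at one point,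
    since proper nonempty sets have a surplus value. *)

(** * Images of sets, gluing of selections, and non-reducible sets *)

Section ImageSet.

Variables X Y : finType.
Implicit Types (F : X -> {set Y}) (V W : {set X}).

Lemma image_setP F W y :
  reflect (exists2 x, x \in W & y \in F x) (y \in image_set F W).
Proof. exact: bigcupP. Qed.

Lemma image_setS F V W : V \subset W -> image_set F V \subset image_set F W.
Proof.
move=> sVW; apply/subsetP => y /image_setP[x xV yx].
by apply/image_setP; exists x; rewrite ?(subsetP sVW).
Qed.

Lemma image_set0 F : image_set F set0 = set0.
Proof. exact: big_set0. Qed.

Lemma image_set1 F x : image_set F [set x] = F x.
Proof. exact: big_set1. Qed.

Lemma image_setU F V W : image_set F (V :|: W) = image_set F V :|: image_set F W.
Proof. exact: bigcup_setU. Qed.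

Lemma image_set_setD F (B : {set Y}) W :
  image_set (fun x => F x :\: B) W = image_set F W :\: B.
Proof.
apply/setP => y; rewrite in_setD; apply/image_setP/andP.
  by case=> x xW; rewrite in_setD => /andP[yB yx]; split=> //; apply/image_setP; exists x.
by case=> yB /image_setP[x xW yx]; exists x; rewrite // in_setD yB.
Qed.

Lemma card_image_setU F V W :
  #|image_set F (V :|: W)| = #|image_set F V| + #|image_set F W :\: image_set F V|.
Proof.
rewrite image_setU cardsU [in RHS]cardsD setIC addnBA ?subset_leq_card //.
exact: subsetIl.
Qed.

Lemma card_disjointU V W : [disjoint V & W] -> #|V :|: W| = #|V| + #|W|.
Proof. by move=> dVW; rewrite cardsU disjoint_setI0 // cards0 subn0. Qed.

Lemma image_set_injective_leq F (s : X -> Y) W :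
  selection F s -> injective s -> #|W| <= #|image_set F W|.
Proof.
move=> sF injs; rewrite -(card_imset W injs); apply/subset_leq_card/subsetP.
by move=> _ /imsetP[x xW ->]; apply/image_setP; exists x.
Qed.

(** The set [B] keeps the two pieces apart: [s1] takes its values on [V] inside [B], [s2] takes its
    values on the rest of [A] outside [B], so no collision occurs across the pieces. *)
Lemma glue_selection F V A (B : {set Y}) (s1 s2 : X -> Y) :
    {in V, forall x, s1 x \in F x :&: B} -> {in V &, injective s1} ->
    {in A :\: V, forall x, s2 x \in F x :\: B} -> {in A :\: V &, injective s2} ->
  exists s : X -> Y, {in A, forall x, s x \in F x} /\ {in A &, injective s}.
Proof.
move=> F1 i1 F2 i2; exists (fun x => if x \in V then s1 x else s2 x).
have inD x : x \in A -> x \in V = false -> x \in A :\: V.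
  by move=> xA xV; rewrite in_setD xV.
split=> [x xA | x y xA yA].
  case: ifP => xV; first by have := F1 x xV; rewrite in_setI => /andP[].
  by have := F2 x (inD x xA xV); rewrite in_setD => /andP[].
have cross u v : u \in V -> v \in A :\: V -> s1 u <> s2 v.
  move=> uV vA e; have := F1 u uV; have := F2 v vA.
  by rewrite in_setD in_setI e => /andP[/negbTE-> _]; rewrite andbF.
case: ifP => xV; case: ifP => yV e.
- exact: i1.
- by case: (cross x y xV (inD y yA yV)).
- by case: (cross y x yV (inD x xA xV)).
- by apply: i2 => //; apply: inD.
Qed.

Lemma nonempty_non_reducible_hall F W :
    {in W, forall x, F x != set0} -> non_reducible F W ->
  forall V, V \subset W -> #|V| <= #|image_set F V|.
Proof.
move=> ne [_ nr] V; have [n] := ubnP #|V|; elim: n V => // n IH V ltVn sVW.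
have [->|[x xV]] := set_0Vmem V; first by rewrite cards0.
have cV : #|V| = #|V :\ x|.+1 by rewrite (cardsD1 x) xV.
have sV : V :\ x \subset V := subD1set _ _.
have le1 := IH (V :\ x) ltac:(lia) (subset_trans sV sVW).
have le2 := subset_leq_card (image_setS F sV).
(* The empty set is never critical, so non-reducibility is silent when [V] is [{x}]; there the bound
   comes from [F x] being nonempty. *)
have [V0|V0] := eqVneq (V :\ x) set0.
  have : 0 < #|F x| by rewrite card_gt0 ne // (subsetP sVW).
  move: (@image_setS F [set x] V); rewrite sub1set xV image_set1.
  by move=> /(_ isT)/subset_leq_card; rewrite cV V0 cards0; lia.
have prV : V :\ x \proper W.
  exact: proper_sub_trans (properD1 xV) sVW.
(* Non-criticality makes [le1] strict, and the extra value pays for [x]. *)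
have : #|image_set F (V :\ x)| != #|V :\ x|.
  by apply/eqP => e; apply: (nr _ prV).
by rewrite cV; lia.
Qed.

End ImageSet.

(** * Hall's marriage theorem on a subset [A] of the domain *)

Lemma hall_marriage (X Y : finType) (y0 : Y) (F : X -> {set Y}) (A : {set X}) :
    (forall W : {set X}, W \subset A -> #|W| <= #|image_set F W|) ->
  exists s : X -> Y, {in A, forall x, s x \in F x} /\ {in A &, injective s}.
Proof.
have [n] := ubnP #|A|; elim: n F A => // n IH F A ltAn hall.
have [->|[x xA]] := set_0Vmem A.
  by exists (fun=> y0); split=> [u|u v]; rewrite in_set0.
(* Common to both cases: once [V] is served from [B], induction serves the rest of [A] with [B]
   deleted. It is applied to a critical [V] with [B] its image, then to [{x}] and [{y}]. *)
have step (V : {set X}) (B : {set Y}) (s1 : X -> Y) : V != set0 -> V \subset A ->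
    {in V, forall u, s1 u \in F u :&: B} -> {in V &, injective s1} ->
    (forall W : {set X}, W \subset A :\: V -> #|W| <= #|image_set F W :\: B|) ->
  exists s : X -> Y, {in A, forall x, s x \in F x} /\ {in A &, injective s}.
  move=> V0 sVA F1 i1 hW.
  have cA : #|A :\: V| < n.
    have := cardsD A V; rewrite (setIidPr sVA).
    by have := subset_leq_card sVA; move: V0; rewrite -card_gt0; lia.
  have [|s2 [F2 i2]] := IH (fun u => F u :\: B) (A :\: V) cA.
    by move=> W /hW; rewrite image_set_setD.
  exact: glue_selection F1 i1 F2 i2.
pose crit (V : {set X}) :=
  [&& V != set0, V \proper A & #|image_set F V| == #|V|].
have [V /and3P[V0 prV /eqP cV]|noV] := pickP crit.
  have sVA := proper_sub prV.
  have [||s1 [F1 i1]] := IH F V.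
  - by have := proper_card prV; lia.
  - by move=> W sWV; apply: hall; apply: subset_trans sVA.
  apply: (step V (image_set F V) s1) => // [u uV|W sW].
    by rewrite in_setI F1 //=; apply/image_setP; exists u; rewrite ?F1.
  move: sW; rewrite subsetD => /andP[sWA dWV].
  (* Subtracting [#|F(V)| = #|V|] from the Hall inequality for the union leaves the one for [W] with
     [F(V)] deleted. *)
  have := hall (V :|: W); rewrite subUset sVA sWA => /(_ isT).
  rewrite card_image_setU card_disjointU; last by rewrite disjoint_sym.
  by rewrite cV leq_add2l.
have [y yx] : exists y, y \in F x.
  apply/set0Pn; rewrite -card_gt0 -(image_set1 F x) -(cards1 x).
  by apply: hall; rewrite sub1set.
apply: (step [set x] [set y] (fun=> y)) => [|||u v|W sW].
- by rewrite -card_gt0 cards1.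
- by rewrite sub1set.
- by move=> u /set1P->; rewrite in_setI yx set11.
- by move=> /set1P-> /set1P->.
move: sW; rewrite subsetD => /andP[sWA dWx].
have [->|W0] := eqVneq W set0; first by rewrite cards0.
have prW : W \proper A.
  rewrite properE sWA; apply/subsetPn; exists x => //.
  by move: dWx; rewrite disjoint_sym disjoints1.
(* Since [W] is not critical, its image has a surplus value, which absorbs the loss of [y]. *)
have := noV W; rewrite /crit W0 prW /=; have := hall W sWA.
by have := cardsD1 y (image_set F W); lia.
Qed.

(** * Critical sets of the reduced map, viewed as subsets of [X] *)

Section ReducedMap.

Variables (X Y : finType) (F : X -> {set Y}).
Implicit Types U V W : {set X}.

(** Criticality for [F_U], stated for subsets of [X] so that the type does not depend on [U]; being
    boolean, it can be fed to [minset]. *)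
Definition criticalb U V :=
  [&& V != set0, V \subset ~: U & #|image_set F V :\: image_set F U| == #|V|].

Lemma image_set_reduced U (V : {set {x | x \notin U}}) :
  image_set (@reduced_map X Y F U) V =
  image_set F (val @: V) :\: image_set F U.
Proof.
rewrite /reduced_map image_set_setD; congr (_ :\: _).
apply/setP => y; apply/image_setP/image_setP => [[x xV yx]|[_ /imsetP[x xV ->] yx]].
  by exists (val x); rewrite ?imset_f.
by exists x.
Qed.

Lemma criticalbP U (V : {set {x | x \notin U}}) :
  reflect (critical (@reduced_map X Y F U) V) (criticalb U (val @: V)).
Proof.
rewrite /critical /criticalb image_set_reduced card_imset; last exact: val_inj.
rewrite imset_eq0.
have -> : val @: V \subset ~: U.
  by apply/subsetP => _ /imsetP[x _ ->]; rewrite in_setC (valP x).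
by apply: (iffP andP) => -[? /eqP].
Qed.

Lemma val_in_reduced_domain U W :
  W \subset ~: U -> val @: in_reduced_domain U W = W.
Proof.
move=> sWU; apply/setP => x; apply/imsetP/idP => [[u]|xW].
  by rewrite inE => uW ->.
have xU : x \notin U by rewrite -in_setC (subsetP sWU).
by exists (Sub x xU); rewrite ?inE SubK.
Qed.

Lemma in_reduced_domain_neq0 U W :
  W \subset ~: U -> W != set0 -> in_reduced_domain U W != set0.
Proof. by move=> sWU W0; rewrite -(imset_eq0 val) val_in_reduced_domain. Qed.

Lemma non_reducible_reduced U W : W != set0 -> W \subset ~: U ->
    (forall V, V \proper W -> ~~ criticalb U V) ->
  non_reducible (@reduced_map X Y F U) (in_reduced_domain U W).
Proof.
move=> W0 sWU min; split; first exact: in_reduced_domain_neq0.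
move=> V prV /criticalbP; apply/negP/min.
have injv : injective (val : {x | x \notin U} -> X) by exact: val_inj.
rewrite properEcard -(val_in_reduced_domain sWU) imsetS ?proper_sub //=.
by rewrite !card_imset // proper_card.
Qed.

(** * The greedy construction of a Hall partition *)

Definition greedy_block U : {set X} :=
  if [pick V | minset (criticalb U) V] is Some V then V else ~: U.

Lemma greedy_block_neq0 U : U != setT -> greedy_block U != set0.
Proof.
rewrite /greedy_block => UT.
case: pickP => [V /minsetp/and3P[] //|_].
by apply: contraNneq UT => CU; rewrite -(setCK U) CU setC0.
Qed.

Lemma greedy_block_sub U : greedy_block U \subset ~: U.
Proof. by rewrite /greedy_block; case: pickP => [V /minsetp/and3P[]|]. Qed.

Lemma greedy_block_critical U : greedy_block U != ~: U -> criticalb U (greedy_block U).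
Proof.
by rewrite /greedy_block; case: pickP => [V /minsetp|]; rewrite ?eqxx.
Qed.

Lemma greedy_block_minimal U V : V \proper greedy_block U -> ~~ criticalb U V.
Proof.
rewrite /greedy_block; case: pickP => [W /minsetP[_ minW]|no] prV; apply/negP => cV.
  by have := prV; rewrite (minW V cV (proper_sub prV)) properxx.
(* In the default case no set is critical at all, since a critical set would contain a minimal
   one. *)
by have [W minW _] := minset_exists cV; have := no W; rewrite minW.
Qed.

Fixpoint greedy_union n : {set X} :=
  if n is n'.+1 then greedy_union n' :|: greedy_block (greedy_union n') else set0.

Lemma greedy_union_homo : {homo greedy_union : i j / i <= j >-> i \subset j}.
Proof.
apply: homo_leq => [U|V U W|n] /=; [exact: subxx|exact: subset_trans|exact: subsetUl].
Qed.

(** Each step adds a nonempty block until [X] is exhausted; this bound forces termination. *)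
Lemma greedy_union_card n : greedy_union n != setT -> n <= #|greedy_union n|.
Proof.
elim: n => // n IH nT.
have nT' : greedy_union n != setT.
  apply: contraNneq nT => e; rewrite -subTset -e; exact: greedy_union_homo.
rewrite /= card_disjointU; last first.
  by rewrite disjoint_sym disjoints_subset greedy_block_sub.
by have := IH nT'; have := greedy_block_neq0 nT'; rewrite -card_gt0; lia.
Qed.

Lemma greedy_union_full : exists n, greedy_union n == setT.
Proof.
exists #|X|.+1; apply/negPn/negP => /greedy_union_card.
by rewrite ltnNge max_card.
Qed.

(** A block that is not critical is the whole complement, and adding it would complete [X]. *)
Lemma greedy_unionS_critical n : greedy_union n.+1 != setT ->
  criticalb (greedy_union n) (greedy_block (greedy_union n)).
Proof.
move=> nT; apply: greedy_block_critical; apply: contraNneq nT => /= ->.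
by rewrite setUCr.
Qed.

Lemma card_image_greedy_union n : greedy_union n != setT ->
  #|image_set F (greedy_union n)| = #|greedy_union n|.
Proof.
elim: n => [|n IH] nT; first by rewrite image_set0 !cards0.
have /and3P[_ sW /eqP cW] := greedy_unionS_critical nT.
have nT' : greedy_union n != setT.
  apply: contraNneq nT => e; rewrite -subTset -e; exact: greedy_union_homo.
rewrite /= card_image_setU cW IH // card_disjointU //.
by rewrite disjoint_sym disjoints_subset.
Qed.

Lemma greedy_preceding_union m (i : 'I_m) :
  preceding_union (fun j : 'I_m => greedy_block (greedy_union j)) i = greedy_union i.
Proof.
case: i => n /= ltnm; rewrite /preceding_union /=.
rewrite -(big_ord_widen m (fun j => greedy_block (greedy_union j)) (ltnW ltnm)).
by elim: n {ltnm} => [|n IH]; rewrite ?big_ord0 // big_ord_recr /= IH.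
Qed.

Lemma bigcup_greedy_block m :
  \bigcup_(i < m) greedy_block (greedy_union i) = greedy_union m.
Proof. by elim: m => [|n IH]; rewrite ?big_ord0 // big_ord_recr /= IH. Qed.

Lemma hall_greedy_partition : 0 < #|X| -> hall_condition F -> admits_hall_partition F.
Proof.
(* Taking [m] least keeps every earlier union proper, so the blocks are nonempty and all but the
   last are critical. *)
move=> hX hall; have [m /eqP mT minm] := ex_minnP greedy_union_full.
have notT (i : nat) : i < m -> greedy_union i != setT.
  by rewrite ltnNge; apply: contra => /minm.
exists m, (fun i => greedy_block (greedy_union i)); split.
- case: m mT {minm notT} => // /= T0.
  by move: hX; rewrite -cardsT -T0 cards0.
- by move=> i; apply/greedy_block_neq0/notT.
- have dis (i j : 'I_m) : i < j ->
    [disjoint greedy_block (greedy_union i) & greedy_block (greedy_union j)].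
    move=> ij; rewrite disjoint_sym disjoints_subset.
    apply: subset_trans (greedy_block_sub _) _; rewrite setCS.
    apply: subset_trans (greedy_union_homo ij).
    exact: subsetUr.
  move=> i j; rewrite neq_ltn => /orP[/dis//|/dis].
  by rewrite disjoint_sym.
- by rewrite bigcup_greedy_block.
- move=> i; rewrite greedy_preceding_union => x _.
  rewrite -card_gt0 /reduced_map.
  have := hall (greedy_union i :|: [set val x]).
  rewrite card_image_setU image_set1 card_image_greedy_union ?notT //.
  rewrite card_disjointU ?cards1 ?leq_add2l //.
  by rewrite disjoint_sym disjoints1 (valP x).
- move=> i; rewrite greedy_preceding_union.
  apply: non_reducible_reduced => [||V]; last exact: greedy_block_minimal.
    exact/greedy_block_neq0/notT.
  exact: greedy_block_sub.
- move=> i ltim; rewrite greedy_preceding_union.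
  apply/criticalbP; rewrite val_in_reduced_domain ?greedy_block_sub //.
  exact/greedy_unionS_critical/notT.
Qed.

(** * From a Hall partition back to the Hall condition, and the equivalence *)

Lemma hall_partition_hall : admits_hall_partition F -> hall_condition F.
Proof.
move=> [m [W [_ _ disW covW valW nrW _]]] V.
pose P := preceding_union W.
pose G i := image_set F (V :&: W i) :\: image_set F (P i).
have sWP i : W i \subset ~: P i.
  rewrite -disjoints_subset; apply/bigcup_disjointP => j ji.
  by apply: disW; rewrite neq_ltn ji orbT.
have leG i : #|V :&: W i| <= #|G i|.
  have sVP : V :&: W i \subset ~: P i := subset_trans (subsetIr _ _) (sWP i).
  (* Both sides are moved to the domain of the reduced map, where the block is non-reducible. *)
  rewrite /G -[in X in _ <= X](val_in_reduced_domain sVP) -image_set_reduced.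
  rewrite -[in X in X <= _](val_in_reduced_domain sVP) card_imset; last exact: val_inj.
  apply: nonempty_non_reducible_hall (nrW i) _ _ => [x|].
    by rewrite inE; apply: valW.
  by apply/subsetP => x; rewrite !inE => /andP[].
have disG i j : i != j -> [disjoint G i & G j].
  wlog ij : i j / i < j.
    by move=> th; rewrite neq_ltn => /orP[] lt; [|rewrite disjoint_sym]; apply: th;
      rewrite // neq_ltn lt.
  (* For [i < j], [G i] lies in [F(W i)], hence in [F(P j)], which [G j] avoids. *)
  move=> _; rewrite disjoints_subset setCD.
  apply: subset_trans (subsetUr _ _); apply: subset_trans (subsetDl _ _) _.
  apply: image_setS; apply: subset_trans (subsetIr _ _) _.
  exact: bigcup_sup.
have -> : #|V| = \sum_i #|V :&: W i|.
  rewrite -[in LHS](setIT V) -covW big_distrr /= -sum1_card.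
  rewrite partition_disjoint_bigcup /=; last first.
    by move=> i j /disW; apply: disjointW; apply: subsetIr.
  by apply: eq_bigr => i _; rewrite sum1_card.
apply: leq_trans (leq_sum _ _) _; first by move=> i _; exact: leG.
under eq_bigr do rewrite -sum1_card.
rewrite -partition_disjoint_bigcup // sum1_card; apply: subset_leq_card.
apply/bigcupsP => i _; apply: subset_trans (subsetDl _ _) (image_setS _ _).
exact: subsetIl.
Qed.

End ReducedMap.

Theorem theorem4p2 (X Y : finType) (hX : 0 < #|X|) (hY : 0 < #|Y|)
    (F : X -> {set Y}) :
  (hall_condition F <-> admits_hall_partition F) /\
  (admits_hall_partition F <-> admits_alldifferent_selection F).
Proof.
split; split; [exact: hall_greedy_partition|exact: hall_partition_hall| |].
  (* The Hall condition serves as the link in both directions between partitions and selections. *)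
  move=> /hall_partition_hall hall; have [y0 _] := card_gt0P hY.
  have [s [sF injs]] := @hall_marriage X Y y0 F setT (fun W _ => hall W).
  by exists s; split=> [x|x y e]; [apply: sF|apply: injs].
move=> [s [sF injs]]; apply: hall_greedy_partition => // W.
exact: image_set_injective_leq sF injs.
Qed.
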